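(* Let $T=(T_1,\ldots,T_d)$ be a commuting operator-valued multishift on $\mathcal H=\oplus_{\alpha\in\mathbb N^d}H_\alpha$ with operator weights $\{A^{(j)}_\alpha:\alpha\in\mathbb N^d,\ j=1,\ldots,d\}$. Then $T$ is strongly circular.
   Context: $\mathbb N$ is the set of non-negative integers, $d\ge1$, $\varepsilon_j\in\mathbb N^d$ has $1$ in the $j$th place and $0$ elsewhere, and $\mathbb T^d$ is the $d$-torus in $\mathbb C^d$. Let $\{H_\alpha:\alpha\in\mathbb N^d\}$ be complex separable Hilbert spaces, $\mathcal H=\oplus_{\alpha\in\mathbb N^d}H_\alpha$ their orthogonal direct sum, and $A^{(j)}_\alpha:H_\alpha\to H_{\alpha+\varepsilon_j}$ bounded linear operators. The operator-valued multishift on $\mathcal H$ with operator weights $\{A^{(j)}_\alpha\}$ is the $d$-tuple $T=(T_1,\dots,T_d)$ given by $T_j(\oplus_\alpha x_\alpha)=\oplus_\alpha A^{(j)}_{\alpha-\varepsilon_j}x_{\alpha-\varepsilon_j}$, where the $\alpha$-entry is $0$ if $\alpha_j=0$. It is called commuting if $\sup_\alpha\|A^{(j)}_\alpha\|<\infty$ for every $j$ (equivalently each $T_j$ is bounded on $\mathcal H$) and $A^{(i)}_{\alpha+\varepsilon_j}A^{(j)}_\alpha=A^{(j)}_{\alpha+\varepsilon_i}A^{(i)}_\alpha$ for all $\alpha,i,j$ (equivalently the $T_j$ commute). A commuting $d$-tuple $S=(S_1,\dots,S_d)$ on a Hilbert space $\mathcal H$ is circular if for every $\lambda=(\lambda_1,\dots,\lambda_d)\in\mathbb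 T^d$ there is a unitary $U_\lambda$ on $\mathcal H$ with $U_\lambda^*S_jU_\lambda=\lambda_jS_j$ for all $j=1,\dots,d$. It is strongly circular if moreover $\lambda\mapsto U_\lambda$ can be chosen to be a unitary representation of $\mathbb T^d$ that is strongly continuous, i.e. for every $h\in\mathcal H$ the function $\lambda\mapsto U_\lambda h$ is continuous on $\mathbb T^d$. *)

(* Defs.v *)
From HB Require Import structures.
From mathcomp Require Import all_boot all_order all_algebra.
From mathcomp Require Import complex finmap.
From mathcomp Require Import all_classical all_reals all_analysis.
From mathcomp Require Import ring lra.

Set Implicit Arguments.
Unset Strict Implicit.
Unset Printing Implicit Defensive.

Import Order.TTheory GRing.Theory Num.Theory.
Import numFieldNormedType.Exports.

Local Open Scope classical_set_scope.
Local Open Scope ring_scope.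
Local Open Scope complex_scope.

HB.mixin Record NormedModule_isHilbert (R : realType) V
    & CompleteNormedModule R[i] V := {
  inner : V -> V -> R[i] ;
  innerDl : forall x y z : V, inner (x + y) z = inner x z + inner y z ;
  innerZl : forall (a : R[i]) (x z : V), inner (a *: x) z = a * inner x z ;
  innerC : forall x y : V, inner y x = (inner x y)^* ;
  inner_norm : forall x : V, `|x| ^+ 2 = inner x x
}.

#[short(type="hilbertType")]
HB.structure Definition Hilbert (R : realType) :=
  {V of CompleteNormedModule R[i] V & NormedModule_isHilbert R V}.

Definition separable (T : topologicalType) : Prop :=
  exists2 D : set T, countable D & dense D.

(* The norm of a normed module over R[i] is valued in R[i]; [rnorm x] is the
   same number seen in R. *)
Definition rnorm (R : realType) (V : normedModType R[i]) (x : V) : R :=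
  complex.Re `|x|.

Section rnorm_theory.
Variables (R : realType) (V : normedModType R[i]).
Implicit Types x y : V.

Lemma normc_real (z : R[i]) : 0 <= z -> z = (complex.Re z)%:C.
Proof. by move=> /ger0_real/RRe_real ->. Qed.

Lemma rnormE x : `|x| = (rnorm x)%:C.
Proof. exact/normc_real. Qed.

Lemma rnorm_ge0 x : 0 <= rnorm x.
Proof. by rewrite -ler0c -rnormE. Qed.

Lemma rnormD x y : rnorm (x + y) <= rnorm x + rnorm y.
Proof. by rewrite -lecR rmorphD /= -!rnormE ler_normD. Qed.

Lemma rnormZ a x : rnorm (a *: x) = complex.Re `|a| * rnorm x.
Proof.
by apply: complexI; rewrite rmorphM /= -!rnormE normrZ -(normc_real (normr_ge0 a)).
Qed.

Lemma rnormN x : rnorm (- x) = rnorm x.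
Proof. by rewrite /rnorm normrN. Qed.

Lemma rnorm0 : rnorm (0 : V) = 0.
Proof. by rewrite /rnorm normr0. Qed.

Lemma rnorm0_eq0 x : rnorm x = 0 -> x = 0.
Proof. by move=> x0; apply: normr0_eq0; rewrite rnormE x0. Qed.

End rnorm_theory.

Section hilbert_theory.
Variables (R : realType) (V : hilbertType R).
Implicit Types x y : V.

Lemma innerDr x y z : inner x (y + z) = inner x y + inner x z.
Proof. by rewrite innerC innerDl rmorphD /= -!innerC. Qed.

Lemma innerZr a x y : inner x (a *: y) = a^* * inner x y.
Proof. by rewrite innerC innerZl rmorphM /= -!innerC. Qed.

Lemma rnorm2_inner x : rnorm x ^+ 2 = complex.Re (inner x x).
Proof. by rewrite -inner_norm rnormE -rmorphXn. Qed.

Lemma rnorm2D x y : rnorm (x + y) ^+ 2 =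
  rnorm x ^+ 2 + rnorm y ^+ 2 + complex.Re (inner x y) *+ 2.
Proof.
rewrite !rnorm2_inner innerDl !innerDr [inner y x]innerC.
by case: (inner x x) (inner x y) (inner y y) => [a b] [c d] [e f] /=; ring.
Qed.

Lemma Re_inner_le x y :
  `|complex.Re (inner x y)| <= rnorm x ^+ 2 + rnorm y ^+ 2.
Proof.
have h1 : 0 <= rnorm (x + y) ^+ 2 by rewrite exprn_ge0 ?rnorm_ge0.
have h2 : 0 <= rnorm (x + - y) ^+ 2 by rewrite exprn_ge0 ?rnorm_ge0.
have yN : - y = (-1) *: y by rewrite scaleN1r.
have eN : complex.Re (inner x (- y)) = - complex.Re (inner x y).
  by rewrite yN innerZr rmorphN rmorph1 mulN1r; case: (inner x y).
move: h1 h2; rewrite !rnorm2D rnormN eN !mulr2n => h1 h2.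
have := sqr_ge0 (rnorm x); have := sqr_ge0 (rnorm y).
by rewrite ler_norml => *; apply/andP; split; lra.
Qed.

Lemma Im_inner_le x y :
  `|complex.Im (inner x y)| <= rnorm x ^+ 2 + rnorm y ^+ 2.
Proof.
have -> : complex.Im (inner x y) = complex.Re (inner x ('i%C *: y)).
  by rewrite innerZr; case: (inner x y) => a b /=; ring.
apply: le_trans (Re_inner_le _ _) _.
by rewrite rnormZ normc_def /= expr0n /= add0r expr1n sqrtr1 mul1r.
Qed.

End hilbert_theory.

Section unordered_sum.
Variables (R : realType) (I : choiceType).
Implicit Types f g u v : I -> R.

(* Unordered sum over I, meaningful for absolutely summable families. *)
Definition usum f : R :=
  fine (\esum_(i in [set: I]) (EFin \o f)^\+ i
        - \esum_(i in [set: I]) (EFin \o f)^\- i)%E.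

Definition summabler f : Prop := summable [set: I] (EFin \o f).

Lemma summabler_le f g : (forall i, `|f i| <= g i) -> summabler g -> summabler f.
Proof.
move=> fg; apply: le_lt_trans; apply: le_esum => i _ /=.
by rewrite lee_fin (le_trans (fg i))// ler_norm.
Qed.

Lemma summablerD f g : summabler f -> summabler g -> summabler (f \+ g).
Proof. exact: summableD. Qed.

Let esumr u := fine (\esum_(i in [set: I]) (u i)%:E).

Lemma esumrK u : (forall i, 0 <= u i) -> summabler u ->
  (\esum_(i in [set: I]) (u i)%:E = (esumr u)%:E)%E.
Proof.
move=> u0 su; rewrite fineK// ge0_fin_numE.
  apply: le_lt_trans su; apply: le_esum => i _ /=.
  by rewrite lee_fin ler_norm.
by apply: esum_ge0 => i _; rewrite lee_fin.
Qed.

Lemma usumB_ge0 u v : (forall i, 0 <= u i) -> (forall i, 0 <= v i) ->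
  summabler u -> summabler v ->
  usum (fun i => u i - v i) = esumr u - esumr v.
Proof.
move=> u0 v0 su sv; rewrite /usum.
have := @esumB R I setT (EFin \o u) (EFin \o v) su sv.
rewrite /= => /(_ (fun i _ => u0 i) (fun i _ => v0 i)).
have -> : ((EFin \o u) \- (EFin \o v))%E = EFin \o (fun i => u i - v i).
  by apply/funext => i /=; rewrite EFinB.
by move=> ->; rewrite !esumrK.
Qed.

Lemma esumr0 : esumr (fun=> 0) = 0.
Proof. by rewrite /esumr esum1. Qed.

Lemma summabler0 : summabler (fun=> 0).
Proof. by rewrite /summabler /summable esum1 // => i _ /=; rewrite normr0. Qed.

Lemma usum_ge0E u : (forall i, 0 <= u i) -> summabler u ->
  (usum u)%:E = (\esum_(i in [set: I]) (u i)%:E)%E.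
Proof.
move=> u0 su; rewrite esumrK//; congr EFin.
rewrite -[RHS]subr0 -esumr0 -usumB_ge0//; last exact: summabler0.
by congr usum; apply/funext => i; rewrite subr0.
Qed.

Let pos f i := Num.max (f i) 0.
Let neg f i := Num.max (- f i) 0.

Let posnegE f : f = (fun i => pos f i - neg f i).
Proof.
apply/funext => i; rewrite /pos /neg.
by case: (leP (f i) 0) => h; case: (leP (- f i) 0) => h'; lra.
Qed.

Let pos_ge0 f i : 0 <= pos f i. Proof. by rewrite /pos le_max lexx orbT. Qed.
Let neg_ge0 f i : 0 <= neg f i. Proof. by rewrite /neg le_max lexx orbT. Qed.

Lemma summabler_abs f : summabler f <-> summabler (fun i => `|f i|).
Proof.
by rewrite /summabler /summable /=; under [X in _ <-> (X < _)%E]eq_esum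
  do rewrite /= normr_id.
Qed.

Let spos f : summabler f -> summabler (pos f).
Proof.
move=> /summabler_abs; apply: summabler_le => i.
by rewrite ger0_norm ?pos_ge0// /pos ge_max ler_norm normr_ge0.
Qed.

Let sneg f : summabler f -> summabler (neg f).
Proof.
move=> /summabler_abs; apply: summabler_le => i.
by rewrite ger0_norm ?neg_ge0// /neg ge_max -normrN ler_norm normr_ge0.
Qed.

Lemma usum_posneg f : summabler f -> usum f = esumr (pos f) - esumr (neg f).
Proof.
move=> sf; rewrite {1}[f]posnegE usumB_ge0//; [exact: spos|exact: sneg].
Qed.

Let esumrD u v : (forall i, 0 <= u i) -> (forall i, 0 <= v i) ->
  summabler u -> summabler v ->
  esumr (u \+ v) = esumr u + esumr v.
Proof.
move=> u0 v0 su sv; apply: EFin_inj; rewrite EFinD -!esumrK//.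
- by rewrite -esumD // => i _; rewrite lee_fin.
- by move=> i /=; rewrite addr_ge0.
- exact: summablerD.
Qed.

Lemma usumD f g : summabler f -> summabler g ->
  usum (f \+ g) = usum f + usum g.
Proof.
move=> sf sg.
have -> : f \+ g = (fun i => (pos f \+ pos g) i - (neg f \+ neg g) i).
  by apply/funext => i; rewrite {1}[f]posnegE {1}[g]posnegE /=; ring.
rewrite usumB_ge0.
- rewrite !esumrD// ?usum_posneg//; first ring;
  by [exact: spos|exact: sneg].
- by move=> i; rewrite addr_ge0.
- by move=> i; rewrite addr_ge0.
- by apply: summablerD; exact: spos.
- by apply: summablerD; exact: sneg.
Qed.

Let esumZ_le k u : 0 <= k -> (forall i, 0 <= u i) -> summabler u ->
  (\esum_(i in [set: I]) (k * u i)%:E <= (k * esumr u)%:E)%E.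
Proof.
move=> k0 u0 su; rewrite EFinM -esumrK//.
apply: ge_ereal_sup => _ [J [finJ _] <-].
under eq_fsbigr do rewrite EFinM.
rewrite -ge0_mule_fsumr; last by move=> i; rewrite lee_fin.
apply: lee_wpmul2l; first by rewrite lee_fin.
by apply: ereal_sup_ubound; exists J.
Qed.

Lemma summablerZ k f : summabler f -> summabler (fun i => k * f i).
Proof.
move=> /summabler_abs sf; apply/summabler_abs; rewrite /summabler /summable /=.
apply: le_lt_trans (ltry (`|k| * esumr (fun i => `|f i|))).
apply: le_trans (@esumZ_le `|k| (fun i => `|f i|) _ _ _) => //.
by apply: le_esum => i _; rewrite lee_fin normr_id normrM.
Qed.

Let esumrZ k u : 0 <= k -> (forall i, 0 <= u i) -> summabler u ->
  esumr (fun i => k * u i) = k * esumr u.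
Proof.
move=> k0 u0 su; have [->|kn0] := eqVneq k 0.
  by rewrite mul0r -[RHS]esumr0; congr esumr; apply/funext => i; rewrite mul0r.
have ku0 i : 0 <= k * u i by rewrite mulr_ge0.
have sku := summablerZ k su.
apply/eqP; rewrite eq_le; apply/andP; split.
  by rewrite -lee_fin -esumrK//; exact: esumZ_le.
have kV0 : 0 <= k^-1 by rewrite invr_ge0.
have := @esumZ_le k^-1 (fun i => k * u i) kV0 ku0 sku.
under eq_esum do rewrite mulKf//.
by rewrite esumrK// lee_fin mulrC ler_pdivlMr ?lt_def ?kn0// mulrC.
Qed.

Lemma usumZ k f : summabler f -> usum (fun i => k * f i) = k * usum f.
Proof.
have usumZ_ge0 k' f' : 0 <= k' -> summabler f' ->
    usum (fun i => k' * f' i) = k' * usum f'.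
  move=> k0 sf.
  have -> : (fun i => k' * f' i) = (fun i => k' * pos f' i - k' * neg f' i).
    by apply/funext => i; rewrite {1}[f']posnegE mulrBr.
  rewrite usumB_ge0.
  - by rewrite !esumrZ// ?usum_posneg ?mulrBr//; [exact: sneg|exact: spos].
  - by move=> i; rewrite mulr_ge0.
  - by move=> i; rewrite mulr_ge0.
  - by apply: summablerZ; exact: spos.
  - by apply: summablerZ; exact: sneg.
move=> sf; have [k0|k0] := leP 0 k; first exact: usumZ_ge0.
have kN0 : 0 <= - k by rewrite oppr_ge0 ltW.
apply/eqP; rewrite -subr_eq0 -mulNr -usumZ_ge0// -usumD.
- have -> : (fun i => k * f i) \+ (fun i => - k * f i) = fun=> 0 - 0.
    by apply/funext => i /=; rewrite mulNr subrr subr0.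
  by rewrite usumB_ge0// ?subrr//; exact: summabler0.
- exact: summablerZ.
- exact: summablerZ.
Qed.

Lemma ler_usum_ge0 u v : (forall i, 0 <= u i <= v i) -> summabler v ->
  usum u <= usum v.
Proof.
move=> uv sv.
have u0 i : 0 <= u i by have /andP[] := uv i.
have v0 i : 0 <= v i by have /andP[? /(le_trans _)->] := uv i.
have su : summabler u.
  by apply: summabler_le sv => i; rewrite ger0_norm//; have /andP[] := uv i.
rewrite -lee_fin !usum_ge0E//; apply: le_esum => i _; rewrite lee_fin.
by have /andP[] := uv i.
Qed.

Lemma usum_ge0 u : (forall i, 0 <= u i) -> summabler u -> 0 <= usum u.
Proof.
move=> u0 su; rewrite -lee_fin usum_ge0E//; apply: esum_ge0 => i _.
by rewrite lee_fin.
Qed.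

Lemma ler_usum_term u i : (forall i, 0 <= u i) -> summabler u -> u i <= usum u.
Proof.
move=> u0 su; rewrite -lee_fin usum_ge0E//.
rewrite -[leLHS](@esum_set1 _ _ i (fun j => (u j)%:E)) ?lee_fin//.
rewrite esum_mkcond; apply: le_esum => j _; case: ifPn => // _.
by rewrite lee_fin.
Qed.

End unordered_sum.

(* The orthogonal direct sum of the Hilbert spaces [H i]: families whose
   squared norms are summable. *)
Record hsum (R : realType) (I : choiceType) (H : I -> hilbertType R) := HSum {
  hsum_val :> forall i, H i ;
  hsum_summable : summabler (fun i => rnorm (hsum_val i) ^+ 2)
}.

Section hsum_lmodule.
Variables (R : realType) (I : choiceType) (H : I -> hilbertType R).
Implicit Types x y z : hsum H.

Lemma hsumP x y : (forall i, x i = y i) -> x = y.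
Proof.
case: x y => [x sx] [y sy] /= xy.
have {}xy : x = y by apply: functional_extensionality_dep.
by case: _ / xy sy => sy; congr HSum; exact: Prop_irrelevance.
Qed.

HB.instance Definition _ := gen_eqMixin (hsum H).
HB.instance Definition _ := gen_choiceMixin (hsum H).

Lemma rnorm2D_le (V : hilbertType R) (a b : V) (t : R) : 0 < t ->
  rnorm (a + b) ^+ 2 <= (1 + t) * rnorm a ^+ 2 + (1 + t^-1) * rnorm b ^+ 2.
Proof.
move=> t0.
have h : rnorm (a + b) ^+ 2 <= (rnorm a + rnorm b) ^+ 2.
  by rewrite lerXn2r ?nnegrE ?addr_ge0 ?rnorm_ge0// rnormD.
apply: le_trans h _; rewrite -subr_ge0.
set p := rnorm a; set q := rnorm b.
have -> : (1 + t) * p ^+ 2 + (1 + t^-1) * q ^+ 2 - (p + q) ^+ 2 =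
    t^-1 * (t * p - q) ^+ 2 by field; rewrite gt_eqF.
by rewrite mulr_ge0 ?sqr_ge0// invr_ge0 ltW.
Qed.

Lemma hsum_summable_lin (a b : R) x y :
  summabler (fun i => a * rnorm (x i) ^+ 2 + b * rnorm (y i) ^+ 2).
Proof.
by apply: summablerD; apply: summablerZ; exact: hsum_summable.
Qed.

Fact hsum_zero_summable : summabler (fun i => rnorm (0 : H i) ^+ 2).
Proof.
by apply: summabler_le (summabler0 R I) => i; rewrite rnorm0 expr0n normr0.
Qed.
Definition hsum_zero : hsum H := HSum hsum_zero_summable.

Fact hsum_opp_summable x : summabler (fun i => rnorm (- x i) ^+ 2).
Proof.
by apply: summabler_le (hsum_summable x) => i; rewrite rnormN ger0_norm ?sqr_ge0.
Qed.
Definition hsum_opp x : hsum H := HSum (hsum_opp_summable x).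

Fact hsum_add_summable x y : summabler (fun i => rnorm (x i + y i) ^+ 2).
Proof.
apply: summabler_le (hsum_summable_lin (1 + 1) (1 + 1^-1) x y) => i.
by rewrite ger0_norm ?sqr_ge0// rnorm2D_le.
Qed.
Definition hsum_add x y : hsum H := HSum (hsum_add_summable x y).

Fact hsum_scale_summable (a : R[i]) x : summabler (fun i => rnorm (a *: x i) ^+ 2).
Proof.
apply: summabler_le (summablerZ (complex.Re `|a| ^+ 2) (hsum_summable x)) => i.
by rewrite ger0_norm ?sqr_ge0// rnormZ exprMn.
Qed.
Definition hsum_scale (a : R[i]) x : hsum H := HSum (hsum_scale_summable a x).

Fact hsum_addA : associative hsum_add.
Proof. by move=> x y z; apply: hsumP => i /=; rewrite addrA. Qed.
Fact hsum_addC : commutative hsum_add.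
Proof. by move=> x y; apply: hsumP => i /=; rewrite addrC. Qed.
Fact hsum_add0 : left_id hsum_zero hsum_add.
Proof. by move=> x; apply: hsumP => i /=; rewrite add0r. Qed.
Fact hsum_addN : left_inverse hsum_zero hsum_opp hsum_add.
Proof. by move=> x; apply: hsumP => i /=; rewrite addNr. Qed.

HB.instance Definition _ :=
  GRing.isZmodule.Build (hsum H) hsum_addA hsum_addC hsum_add0 hsum_addN.

Fact hsum_scaleA a b x : hsum_scale a (hsum_scale b x) = hsum_scale (a * b) x.
Proof. by apply: hsumP => i /=; rewrite scalerA. Qed.
Fact hsum_scale1 : left_id 1 hsum_scale.
Proof. by move=> x; apply: hsumP => i /=; rewrite scale1r. Qed.
Fact hsum_scaleDr : right_distributive hsum_scale +%R.
Proof. by move=> a x y; apply: hsumP => i /=; rewrite scalerDr. Qed.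
Fact hsum_scaleDl x : {morph hsum_scale^~ x : a b / a + b}.
Proof. by move=> a b; apply: hsumP => i /=; rewrite scalerDl. Qed.

HB.instance Definition _ := GRing.Zmodule_isLmodule.Build R[i] (hsum H)
  hsum_scaleA hsum_scale1 hsum_scaleDr hsum_scaleDl.

Lemma hsum_valD x y i : (x + y) i = x i + y i. Proof. by []. Qed.
Lemma hsum_valN x i : (- x) i = - x i. Proof. by []. Qed.
Lemma hsum_valB x y i : (x - y) i = x i - y i. Proof. by []. Qed.
Lemma hsum_val0 i : (0 : hsum H) i = 0. Proof. by []. Qed.
Lemma hsum_valZ a x i : (a *: x) i = a *: x i. Proof. by []. Qed.

End hsum_lmodule.

Section hsum_normed.
Variables (R : realType) (I : choiceType) (H : I -> hilbertType R).
Implicit Types x y z : hsum H.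

Definition hsum_sqnorm x : R := usum (fun i => rnorm (x i) ^+ 2).

Definition hsum_norm x : R[i] := (Num.sqrt (hsum_sqnorm x))%:C.

Lemma hsum_sqnorm_ge0 x : 0 <= hsum_sqnorm x.
Proof. by apply: usum_ge0 (hsum_summable x) => i; exact: sqr_ge0. Qed.

Lemma hsum_sqnormD x y (t : R) : 0 < t ->
  hsum_sqnorm (x + y) <= (1 + t) * hsum_sqnorm x + (1 + t^-1) * hsum_sqnorm y.
Proof.
move=> t0; rewrite /hsum_sqnorm -!usumZ; try exact: hsum_summable.
rewrite -usumD; try by apply: summablerZ; exact: hsum_summable.
apply: ler_usum_ge0; last exact: (hsum_summable_lin (1 + t) (1 + t^-1) x y).
by move=> i; rewrite sqr_ge0/= rnorm2D_le.
Qed.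

Lemma hsum_sqnorm_eq0 x : hsum_sqnorm x = 0 -> x = 0.
Proof.
move=> x0; apply: hsumP => i; apply: rnorm0_eq0; apply/eqP.
rewrite -sqrf_eq0 eq_le sqr_ge0 andbT -x0.
apply: (@ler_usum_term _ _ (fun i => rnorm (x i) ^+ 2)); last exact: hsum_summable.
by move=> j; exact: sqr_ge0.
Qed.

Fact hsum_normD x y : hsum_norm (x + y) <= hsum_norm x + hsum_norm y.
Proof.
rewrite /hsum_norm -rmorphD /= lecR.
have [/eqP x0|xn0] := eqVneq (hsum_sqnorm x) 0.
  by move/eqP: x0 => /hsum_sqnorm_eq0 ->; rewrite add0r lerDr sqrtr_ge0.
have [/eqP y0|yn0] := eqVneq (hsum_sqnorm y) 0.
  by move/eqP: y0 => /hsum_sqnorm_eq0 ->; rewrite addr0 lerDl sqrtr_ge0.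
have p0 : 0 < Num.sqrt (hsum_sqnorm x) by rewrite sqrtr_gt0 lt_def xn0 hsum_sqnorm_ge0.
have q0 : 0 < Num.sqrt (hsum_sqnorm y) by rewrite sqrtr_gt0 lt_def yn0 hsum_sqnorm_ge0.
set p := Num.sqrt (hsum_sqnorm x) in p0 *.
set q := Num.sqrt (hsum_sqnorm y) in q0 *.
rewrite -(@ler_pXn2r _ 2)// ?nnegrE ?sqrtr_ge0 ?addr_ge0 ?sqrtr_ge0//.
rewrite sqr_sqrtr ?hsum_sqnorm_ge0//.
apply: le_trans (@hsum_sqnormD x y (q / p) _) _; first by rewrite divr_gt0.
rewrite -[hsum_sqnorm x]sqr_sqrtr ?hsum_sqnorm_ge0//.
rewrite -[hsum_sqnorm y]sqr_sqrtr ?hsum_sqnorm_ge0// -/p -/q.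
rewrite le_eqVlt; apply/orP; left; apply/eqP.
by field; rewrite !gt_eqF.
Qed.

Fact hsum_normZ (a : R[i]) x : hsum_norm (a *: x) = `|a| * hsum_norm x.
Proof.
rewrite /hsum_norm; have a0 := normr_ge0 a.
rewrite [X in X * _](normc_real a0) -rmorphM /=; congr (_%:C).
have r0 : 0 <= complex.Re `|a| by rewrite -ler0c -normc_real.
have -> : hsum_sqnorm (a *: x) = complex.Re `|a| ^+ 2 * hsum_sqnorm x.
  rewrite /hsum_sqnorm -usumZ; last exact: hsum_summable.
  by congr usum; apply/funext => i; rewrite hsum_valZ rnormZ exprMn.
by rewrite sqrtrM ?sqr_ge0// sqrtr_sqr ger0_norm.
Qed.

Fact hsum_norm_eq0 x : hsum_norm x = 0 -> x = 0.
Proof.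
move=> /(congr1 (@complex.Re R)) /= /eqP; rewrite sqrtr_eq0 => x0.
by apply: hsum_sqnorm_eq0; apply/eqP; rewrite eq_le x0 hsum_sqnorm_ge0.
Qed.

HB.instance Definition _ := @Lmodule_isNormed.Build R[i] (hsum H)
  hsum_norm hsum_normD hsum_normZ hsum_norm_eq0.

Lemma hsum_normE x : `|x| = (Num.sqrt (hsum_sqnorm x))%:C.
Proof. by []. Qed.

Lemma hsum_rnorm2 x : rnorm x ^+ 2 = hsum_sqnorm x.
Proof. by rewrite /rnorm hsum_normE /= sqr_sqrtr// hsum_sqnorm_ge0. Qed.

Lemma hsum_rnorm_term x i : rnorm (x i) <= rnorm x.
Proof.
rewrite -(@ler_pXn2r _ 2)// ?nnegrE ?rnorm_ge0// hsum_rnorm2.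
apply: (@ler_usum_term _ _ (fun i => rnorm (x i) ^+ 2)); last exact: hsum_summable.
by move=> j; exact: sqr_ge0.
Qed.

Lemma summabler_bound (u : I -> R) (M : R) : (forall i, 0 <= u i) ->
  (forall J : {fset I}, \sum_(i <- J) u i <= M) -> summabler u.
Proof.
move=> u0 uM; apply: le_lt_trans (ltry M).
apply: ge_ereal_sup => _ [J [finJ _] <-] /=.
rewrite fsbig_finite//= (le_trans _ (_ : (\sum_(i <- fset_set J) u i)%:E <= M%:E)%E)//.
  by rewrite sumEFin lee_fin; apply: ler_sum => i _; rewrite ger0_norm.
by rewrite lee_fin.
Qed.

Lemma ler_usum_bound (u : I -> R) (M : R) : (forall i, 0 <= u i) ->
  (forall J : {fset I}, \sum_(i <- J) u i <= M) -> usum u <= M.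
Proof.
move=> u0 uM; have su := summabler_bound u0 uM.
rewrite -lee_fin usum_ge0E//.
apply: ge_ereal_sup => _ [J [finJ _] <-] /=.
by rewrite fsbig_finite//= sumEFin lee_fin.
Qed.

Lemma ler_usum_fset (u : I -> R) (J : {fset I}) : (forall i, 0 <= u i) ->
  summabler u -> \sum_(i <- J) u i <= usum u.
Proof.
move=> u0 su; rewrite -lee_fin usum_ge0E// -sumEFin.
apply: ereal_sup_ubound; exists [set` J]; first by split.
by rewrite fsbig_finite//= set_fsetK.
Qed.

End hsum_normed.

Section hsum_complete.
Variables (R : realType) (I : choiceType) (H : I -> hilbertType R).
Implicit Types x y z : hsum H.

Lemma ball_rnorm (V : normedModType R[i]) (a b : V) (e : R) :
  ball a e%:C b <-> rnorm (a - b) < e.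
Proof. by rewrite -ball_normE /ball_ /= rnormE ltcR. Qed.

Let proj i x : H i := x i.

Lemma hsum_complete (F : set_system (hsum H)) :
  ProperFilter F -> cauchy F -> cvg F.
Proof.
move=> FF /cauchyP Fc.
have Fb (e : R) : 0 < e -> exists x, F (fun z => rnorm (x - z) < e).
  move=> e0; have [|x Fx] := Fc e%:C; first by rewrite ltcR.
  by exists x; apply: filterS Fx => z /ball_rnorm.
pose y i : H i := lim (proj i @ F).
have yP i (e : R) : 0 < e -> F (fun z => rnorm (z i - y i) < e).
  move=> e0; have ci : cvg (proj i @ F).
    apply/cauchy_cvgP/cauchyP => eps eps0.
    have epsE := normc_real (ltW eps0).
    have [|x Fx] := Fb (complex.Re eps); first by rewrite -ltcR -epsE.
    exists (x i); rewrite epsE.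
    suff : F (fun z => ball (x i) (complex.Re eps)%:C (z i)) by [].
    apply: filterS Fx => z xz.
    apply/ball_rnorm; apply: le_lt_trans xz.
    exact: (hsum_rnorm_term (x - z) i).
  have /cvg_ball/(_ e%:C) : proj i @ F --> y i by [].
  rewrite ltcR => /(_ e0) yF.
  have {}yF : F (fun z => ball (y i) e%:C (z i)) by exact: yF.
  by apply: filterS yF => z /ball_rnorm; rewrite -rnormN opprB.
have key (e : R) x : 0 < e -> F (fun z => rnorm (x - z) < e) ->
    forall J : {fset I}, \sum_(i <- J) rnorm (x i - y i) ^+ 2 <= 4 * e ^+ 2.
  move=> e0 Fx J.
  have sJ : 0 < (size J).+1%:R :> R by [].
  pose c := Num.sqrt (e ^+ 2 / (size J).+1%:R).
  have c0 : 0 < c by rewrite sqrtr_gt0 divr_gt0 ?exprn_gt0.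
  have FJ : F (fun z => forall i, i \in J -> rnorm (z i - y i) < c).
    have := @filter_bigI _ I J (fun i z => rnorm (z i - y i) < c) F FF
      (fun i _ => yP i c c0).
    by apply: filterS => z zJ i iJ; exact: zJ.
  have [z [xz zJ]] := filter_ex (filterI Fx FJ).
  have h i : i \in J -> rnorm (x i - y i) ^+ 2 <=
      2 * rnorm ((x - z) i) ^+ 2 + 2 * (e ^+ 2 / (size J).+1%:R).
    move=> iJ; have := @rnorm2D_le R (H i) (x i - z i) (z i - y i) 1 ltr01.
    rewrite addrA subrK invr1 => /le_trans; apply.
    rewrite -[1 + 1]/(2 : R) lerD2l ler_pM2l// ltW//.
    rewrite -[ltRHS]sqr_sqrtr ?divr_ge0 ?sqr_ge0// -/c.
    by rewrite ltrXn2r//= ?rnorm_ge0 ?zJ.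
  rewrite big_seq; apply: le_trans (ler_sum _ h) _.
  rewrite -big_seq big_split /= -mulr_sumr.
  have -> : 4 * e ^+ 2 = 2 * e ^+ 2 + 2 * e ^+ 2 by ring.
  apply: lerD.
    rewrite ler_pM2l//.
    apply: (@le_trans _ _ (rnorm (x - z) ^+ 2)); last first.
      by rewrite lerXn2r ?nnegrE ?rnorm_ge0 ?(ltW e0) ?(ltW xz).
    rewrite hsum_rnorm2; apply: (@ler_usum_fset _ _ (fun i => rnorm ((x - z) i) ^+ 2)).
      by move=> i; exact: sqr_ge0.
    exact: hsum_summable.
  rewrite big_const_seq count_predT iter_addr addr0 -[leLHS]mulr_natr.
  rewrite -mulrA ler_pM2l// mulrAC -mulrA ler_piMr ?sqr_ge0//.
  by rewrite ler_pdivrMr// mul1r ler_nat.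
have ysum : summabler (fun i => rnorm (y i) ^+ 2).
  have [x Fx] := Fb 1 ltr01.
  have sxy : summabler (fun i => rnorm (x i - y i) ^+ 2).
    by apply: summabler_bound (key 1 x ltr01 Fx) => i; exact: sqr_ge0.
  have -> : (fun i => rnorm (y i) ^+ 2) =
      (fun i => rnorm ((x - HSum sxy) i) ^+ 2).
    by apply/funext => i; rewrite hsum_valB /= opprB addrC subrK.
  exact: hsum_summable.
apply/cvg_ex; exists (HSum ysum); apply/cvg_ballP => eps eps0.
have epsE := normc_real (ltW eps0); rewrite epsE.
set e := complex.Re eps.
have e0 : 0 < e by rewrite -ltcR -epsE.
have e40 : 0 < e / 4 by rewrite divr_gt0.
have [x Fx] := Fb _ e40.
apply: filterS (Fx) => z xz; apply/ball_rnorm.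
have -> : HSum ysum - z = - (x - HSum ysum) + (x - z).
  by rewrite opprB addrA subrK.
apply: le_lt_trans (rnormD _ _) _; rewrite rnormN.
have : rnorm (x - HSum ysum) <= e / 2.
  rewrite -(@ler_pXn2r _ 2)// ?nnegrE ?rnorm_ge0// ?divr_ge0 ?(ltW e0)//.
  rewrite hsum_rnorm2; apply: ler_usum_bound; first by move=> i; exact: sqr_ge0.
  move=> J; apply: le_trans (key _ _ e40 Fx J) _.
  by rewrite le_eqVlt; apply/orP; left; apply/eqP; field.
lra.
Qed.

HB.instance Definition _ := Uniform_isComplete.Build (hsum H) hsum_complete.

End hsum_complete.

Section hsum_hilbert.
Variables (R : realType) (I : choiceType) (H : I -> hilbertType R).
Implicit Types x y z : hsum H.

Definition hsum_inner x y : R[i] :=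
  usum (fun i => complex.Re (inner (x i) (y i))) +i*
  usum (fun i => complex.Im (inner (x i) (y i))).

Lemma hsum_Re_summable x y : summabler (fun i => complex.Re (inner (x i) (y i))).
Proof.
apply: summabler_le (summablerD (hsum_summable x) (hsum_summable y)) => i.
exact: Re_inner_le.
Qed.

Lemma hsum_Im_summable x y : summabler (fun i => complex.Im (inner (x i) (y i))).
Proof.
apply: summabler_le (summablerD (hsum_summable x) (hsum_summable y)) => i.
exact: Im_inner_le.
Qed.

Let sRe := hsum_Re_summable.
Let sIm := hsum_Im_summable.

Fact hsum_innerDl x y z : hsum_inner (x + y) z = hsum_inner x z + hsum_inner y z.
Proof.
rewrite /hsum_inner; apply/eqP; rewrite eq_complex /= -!usumD//.
apply/andP; split; apply/eqP; congr usum; apply/funext => i /=;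
by rewrite innerDl; case: (inner (x i)) (inner (y i)) => [a b] [c d].
Qed.

Fact hsum_innerZl (a : R[i]) x z : hsum_inner (a *: x) z = a * hsum_inner x z.
Proof.
case: a => a b; apply/eqP; rewrite eq_complex /=; apply/andP; split; apply/eqP.
  rewrite -mulNr -!usumZ// -usumD; try exact: summablerZ.
  congr usum; apply/funext => i /=.
  by rewrite innerZl; case: (inner (x i) (z i)) => u v /=; rewrite mulNr.
rewrite -!usumZ// -usumD; try exact: summablerZ.
congr usum; apply/funext => i /=.
by rewrite innerZl; case: (inner (x i) (z i)) => u v /=.
Qed.

Fact hsum_innerC x y : hsum_inner y x = (hsum_inner x y)^*.
Proof.
apply/eqP; rewrite eq_complex /=; apply/andP; split; apply/eqP.
  congr usum; apply/funext => i.
  by rewrite (innerC (x i)); case: (inner (x i) (y i)).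
rewrite -mulN1r -usumZ//; congr usum; apply/funext => i.
by rewrite (innerC (x i)) mulN1r; case: (inner (x i) (y i)).
Qed.

Fact hsum_inner_norm x : `|x| ^+ 2 = hsum_inner x x.
Proof.
rewrite rnormE -rmorphXn hsum_rnorm2 /=.
apply/eqP; rewrite eq_complex /=; apply/andP; split; apply/eqP.
  by congr usum; apply/funext => i; rewrite rnorm2_inner.
have -> : (fun i => complex.Im (inner (x i) (x i))) = fun i => 0 * rnorm (x i) ^+ 2.
  by apply/funext => i; rewrite mul0r -inner_norm rnormE -rmorphXn.
by rewrite usumZ ?mul0r//; exact: hsum_summable.
Qed.

HB.instance Definition _ := @NormedModule_isHilbert.Build R (hsum H)
  hsum_inner hsum_innerDl hsum_innerZl hsum_innerC hsum_inner_norm.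

End hsum_hilbert.

Definition opnorm (R : realType) (V W : normedModType R[i]) (f : V -> W) : \bar R :=
  ereal_sup [set (rnorm (f x))%:E | x in [set x | rnorm x <= 1]].

Section opnorm_theory.
Variables (R : realType) (V W : normedModType R[i]).

Lemma opnorm_ge0 (f : V -> W) : (0 <= opnorm f)%E.
Proof.
apply: (@le_trans _ _ (rnorm (f 0))%:E); first by rewrite lee_fin rnorm_ge0.
by apply: ereal_sup_ubound; exists 0 => //=; rewrite rnorm0.
Qed.

Lemma opnorm_le (f : {linear V -> W}) (M : R) : (opnorm f <= M%:E)%E ->
  forall x, rnorm (f x) <= M * rnorm x.
Proof.
move=> fM x; have [/eqP x0|x0] := eqVneq (rnorm x) 0.
  by move/eqP: x0 => /rnorm0_eq0 ->; rewrite linear0 !rnorm0 mulr0.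
have p0 : 0 < rnorm x by rewrite lt_def x0 rnorm_ge0.
have nV : complex.Re `|((rnorm x)^-1)%:C| = (rnorm x)^-1.
  by rewrite ger0_norm ?ler0c ?invr_ge0 ?rnorm_ge0.
rewrite -ler_pdivrMr// mulrC -nV -rnormZ -linearZ -lee_fin.
apply: le_trans fM; apply: ereal_sup_ubound => /=.
by exists (((rnorm x)^-1)%:C *: x) => //=; rewrite rnormZ nV mulVf.
Qed.

Lemma ge_opnorm (f : V -> W) (M : R) : 0 <= M ->
  (forall x, rnorm (f x) <= M * rnorm x) -> (opnorm f <= M%:E)%E.
Proof.
move=> M0 fM; apply: ge_ereal_sup => _ [x /= x1 <-]; rewrite lee_fin.
by apply: le_trans (fM x) _; rewrite ler_piMr.
Qed.

End opnorm_theory.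

Definition bounded_operator (R : realType) (V W : normedModType R[i])
  (f : V -> W) : Prop := (opnorm f < +oo)%E.

(* [adjoint f y] is the unique z such that <f x, y> = <x, z> for all x; it
   exists for every bounded linear f by the Riesz representation theorem. *)
Definition adjoint (R : realType) (V W : hilbertType R) (f : V -> W) (y : W) : V :=
  xget 0 [set z | forall x, inner (f x) y = inner x z].

Lemma inner_inj (R : realType) (V : hilbertType R) (y z : V) :
  (forall x, inner x y = inner x z) -> y = z.
Proof.
move=> yz; apply/eqP; rewrite -subr_eq0 -normr_eq0 -sqrf_eq0 inner_norm.
by rewrite innerDr -scaleN1r innerZr yz rmorphN rmorph1 mulN1r subrr.
Qed.

Lemma adjointE (R : realType) (V W : hilbertType R) (f : V -> W) (g : W -> V) :
  (forall x y, inner (f x) y = inner x (g y)) -> adjoint f =1 g.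
Proof.
move=> fg y; apply: xget_unique => [x|z zP]; first exact: fg.
by apply: inner_inj => x; rewrite -zP fg.
Qed.

Record unitary (R : realType) (V : hilbertType R) (U : {linear V -> V}) : Prop :=
  Unitary {
    unitary_bounded : bounded_operator U ;
    unitary_adjoint : forall x y, inner (U x) y = inner x (adjoint U y) ;
    unitaryK : forall x, adjoint U (U x) = x ;
    unitaryVK : forall x, U (adjoint U x) = x
  }.

Record commuting_tuple (d : nat) (R : realType) (V : hilbertType R) :=
  CommutingTuple {
    tuple_op :> 'I_d -> {linear V -> V} ;
    tuple_bounded : forall j, bounded_operator (tuple_op j) ;
    tuple_comm : forall i j x,
      tuple_op i (tuple_op j x) = tuple_op j (tuple_op i x)
  }.

Notation multi_index d := {ffun 'I_d -> nat}.

Definition unit_index (d : nat) (j : 'I_d) : multi_index d :=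
  [ffun k => nat_of_bool (k == j)].

Definition pred_index (d : nat) (j : 'I_d) (a : multi_index d) : multi_index d :=
  [ffun k => (a k - unit_index j k)%N].

Lemma pred_indexK (d : nat) (j : 'I_d) (a : multi_index d) :
  (0 < a j)%N -> pred_index j a + unit_index j = a.
Proof.
move=> aj; apply/ffunP => k; rewrite !ffunE.
by case: eqVneq => [->|_]; [exact: subnK|rewrite subn0 addr0].
Qed.

Lemma unit_indexK (d : nat) (j : 'I_d) (a : multi_index d) :
  pred_index j (a + unit_index j) = a.
Proof. by apply/ffunP => k; rewrite !ffunE addnK. Qed.

Lemma unit_index_gt0 (d : nat) (j : 'I_d) (a : multi_index d) :
  (0 < (a + unit_index j)%R j)%N.
Proof. by rewrite !ffunE eqxx; exact: ltn_addl. Qed.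

Definition weights (d : nat) (R : realType) (H : multi_index d -> hilbertType R) :=
  forall (j : 'I_d) (a : multi_index d), {linear H a -> H (a + unit_index j)}.

(* The cast identifies H (a + e_j + e_i) and H (a + e_i + e_j). *)
Record commuting_weights (d : nat) (R : realType)
    (H : multi_index d -> hilbertType R) (A : weights H) : Prop :=
  CommutingWeights {
    weights_bounded : forall j,
      (ereal_sup (range (fun a => opnorm (A j a))) < +oo)%E ;
    weights_comm : forall a i j x,
      ecast b (H b) (addrAC a (unit_index j) (unit_index i))
        (A i (a + unit_index j) (A j a x)) =
      A j (a + unit_index i) (A i a x)
  }.

Section multishift.
Variables (d : nat) (R : realType) (H : multi_index d -> hilbertType R).
Variable A : weights H.
Implicit Types (i j : 'I_d) (a b : multi_index d) (x : forall a, H a).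

(* The family whose a-entry is A_(a - e_j) x_(a - e_j), and 0 if a_j = 0; the
   cast identifies H (a - e_j + e_j) and H a. *)
Definition shift_family j x a : H a :=
  if pselect (0 < a j)%N is left aj then
    ecast c (H c) (pred_indexK aj) (A j (pred_index j a) (x (pred_index j a)))
  else 0.

Lemma shift_family0 j x a : a j = 0%N -> shift_family j x a = 0.
Proof. by rewrite /shift_family => aj0; case: pselect => // aj; exfalso; rewrite aj0 in aj. Qed.

Lemma shift_familyS j x a : shift_family j x (a + unit_index j) = A j a (x a).
Proof.
rewrite /shift_family; case: pselect => [aj|]; last by rewrite unit_index_gt0.
move: (pred_indexK aj); rewrite unit_indexK => e.
by rewrite (eq_axiomK e).
Qed.

Lemma multi_index_ind j (P : multi_index d -> Prop) :
  (forall a, a j = 0%N -> P a) -> (forall a, P (a + unit_index j)) ->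
  forall a, P a.
Proof.
move=> P0 PS a; have [aj|] := posnP (a j); first exact: P0.
by move=> /pred_indexK <-.
Qed.

Hypothesis cA : commuting_weights A.

Lemma weights_bound j : exists2 M : R, 0 <= M &
  forall a (x : H a), rnorm (A j a x) <= M * rnorm x.
Proof.
have := weights_bounded cA j; set s := ereal_sup _ => soo.
have s0 : (0 <= s)%E.
  apply: le_trans (opnorm_ge0 (A j 0)) _.
  by apply: ereal_sup_ubound; exists 0.
have sE : s = (fine s)%:E by rewrite fineK// ge0_fin_numE.
exists (fine s); first exact: fine_ge0.
move=> a; apply: opnorm_le; rewrite -sE.
by apply: ereal_sup_ubound; exists a.
Qed.

Lemma shift_family_sum (j : 'I_d) (M : R) (x : hsum H) : 0 <= M ->
  (forall a (y : H a), rnorm (A j a y) <= M * rnorm y) ->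
  summabler (fun a => rnorm (shift_family j x a) ^+ 2) /\
  usum (fun a => rnorm (shift_family j x a) ^+ 2) <= M ^+ 2 * hsum_sqnorm x.
Proof.
move=> M0 AM.
have bound (J : {fset multi_index d}) :
    \sum_(a <- J) rnorm (shift_family j x a) ^+ 2 <= M ^+ 2 * hsum_sqnorm x.
  rewrite (bigID (fun a : multi_index d => (0 < a j)%N)) /=.
  rewrite [X in _ + X]big1 ?addr0; last first.
    by move=> a; rewrite -eqn0Ngt => /eqP aj; rewrite shift_family0// rnorm0 expr0n.
  pose K : {fset multi_index d} :=
    [fset pred_index j a | a in J & (0 < a j)%N]%fset.
  apply: (@le_trans _ _ (\sum_(b <- K) M ^+ 2 * rnorm (x b) ^+ 2)); last first.
    rewrite -mulr_sumr ler_wpM2l ?sqr_ge0//.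
    apply: (@ler_usum_fset _ _ (fun b => rnorm (x b) ^+ 2)).
      by move=> b; exact: sqr_ge0.
    exact: hsum_summable.
  rewrite big_imfset /=; last first.
    move=> a b /andP[_ aj] /andP[_ bj] ab.
    by rewrite -(pred_indexK aj) ab pred_indexK.
  rewrite big_filter; apply: ler_sum => a aj.
  suff : rnorm (shift_family j x (pred_index j a + unit_index j)) ^+ 2 <=
      M ^+ 2 * rnorm (x (pred_index j a)) ^+ 2 by rewrite (pred_indexK aj).
  rewrite shift_familyS -exprMn.
  by rewrite lerXn2r ?nnegrE ?mulr_ge0 ?rnorm_ge0.
split; first by apply: summabler_bound bound => a; exact: sqr_ge0.
by apply: ler_usum_bound bound => a; exact: sqr_ge0.
Qed.

Lemma shift_summable j (x : hsum H) :
  summabler (fun a => rnorm (shift_family j x a) ^+ 2).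
Proof. by have [M M0 /shift_family_sum -/(_ x M0)[]] := weights_bound j. Qed.

Definition multishift_op j (x : hsum H) : hsum H := HSum (shift_summable j x).

Fact multishift_op_linear j : linear (multishift_op j).
Proof.
move=> k x y; apply: hsumP; apply: (@multi_index_ind j) => a.
  by move=> aj; rewrite hsum_valD hsum_valZ /= !shift_family0// scaler0 addr0.
by rewrite hsum_valD hsum_valZ /= !shift_familyS linearP.
Qed.

HB.instance Definition _ j :=
  GRing.isLinear.Build R[i] (hsum H) (hsum H) *:%R (multishift_op j)
    (multishift_op_linear j).

Fact multishift_bounded j : bounded_operator (multishift_op j).
Proof.
have [M M0 AM] := weights_bound j.
apply: le_lt_trans (ltry M); apply: ge_opnorm => // x.
rewrite -(@ler_pXn2r _ 2)// ?nnegrE ?mulr_ge0 ?rnorm_ge0// exprMn !hsum_rnorm2.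
by have [] := shift_family_sum x M0 AM.
Qed.

Lemma shift_family_cast j x a b (e : a = b) :
  ecast c (H c) e (shift_family j x a) = shift_family j x b.
Proof. by case: _ / e. Qed.

Fact multishift_comm i j (x : hsum H) :
  multishift_op i (multishift_op j x) = multishift_op j (multishift_op i x).
Proof.
have [->//|ij] := eqVneq i j.
have unit0 (k l : 'I_d) : k != l -> unit_index k l = 0%N.
  by rewrite ffunE eq_sym => /negPf ->.
have shift0 (k l : 'I_d) (y : forall a, H a) a : k != l -> a k = 0%N ->
    shift_family l (shift_family k y) a = 0.
  move=> kl; move: a; apply: (@multi_index_ind l) => a.
    by move=> al _; rewrite shift_family0.
  rewrite ffunE unit0 1?eq_sym// addr0 => ak.
  by rewrite shift_familyS shift_family0// linear0.
apply: hsumP => /=; apply: (@multi_index_ind i) => a.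
  by move=> ai; rewrite shift_family0// shift0.
move: a; apply: (@multi_index_ind j) => a.
  move=> aj; have aij : (a + unit_index i) j = 0%N by rewrite ffunE aj unit0.
  by rewrite [RHS]shift_family0// shift0// eq_sym.
rewrite !shift_familyS.
rewrite -[RHS](shift_family_cast _ _ (addrAC a (unit_index i) (unit_index j))).
by rewrite !shift_familyS (weights_comm cA).
Qed.

Definition multishift : commuting_tuple d (hsum H) :=
  @CommutingTuple d R (hsum H) (fun j => multishift_op j : {linear hsum H -> hsum H})
    multishift_bounded multishift_comm.

Lemma multishiftE j (x : hsum H) a : multishift j x a = shift_family j x a.
Proof. by []. Qed.

End multishift.

Definition torus (d : nat) (R : realType) : set 'rV[R[i]^o]_d :=
  [set l | forall j, `|l ord0 j| = 1].

Arguments torus : clear implicits.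

Section circular.
Variables (d : nat) (R : realType) (V : hilbertType R).
Implicit Types (S : commuting_tuple d V) (l m : 'rV[R[i]^o]_d).

Definition rotates S l (U : {linear V -> V}) : Prop :=
  unitary U /\ forall j x, adjoint U (S j (U x)) = l ord0 j *: S j x.

Definition circular S : Prop :=
  forall l, torus d R l -> exists U, rotates S l U.

(* Only the values of U on the torus matter. *)
Definition torus_representation (U : 'rV[R[i]^o]_d -> {linear V -> V}) : Prop :=
  [/\ forall l, torus d R l -> unitary (U l),
      forall x, U (const_mx 1) x = x &
      forall l m, torus d R l -> torus d R m ->
        forall x, U (map2_mx *%R l m) x = U l (U m x)].

Definition strongly_continuous (U : 'rV[R[i]^o]_d -> {linear V -> V}) : Prop :=
  forall h : V, {within torus d R, continuous (fun l => U l h)}.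

Definition strongly_circular S : Prop :=
  circular S /\
  exists U : 'rV[R[i]^o]_d -> {linear V -> V},
    [/\ forall l, torus d R l -> rotates S l (U l),
        torus_representation U & strongly_continuous U].

End circular.

(* Main.v *)
Require Import Defs.
From HB Require Import structures.
From mathcomp Require Import all_boot all_order all_algebra.
From mathcomp Require Import complex finmap.
From mathcomp Require Import all_classical all_reals all_analysis.
From mathcomp Require Import lra.

Set Implicit Arguments.
Unset Strict Implicit.
Unset Printing Implicit Defensive.

Import Order.TTheory GRing.Theory Num.Theory.
Import numFieldNormedType.Exports.

Local Open Scope classical_set_scope.
Local Open Scope ring_scope.
Local Open Scope complex_scope.

(** The operator rotating the shift through l in the torus is diagonal: on the
    summand H a it is multiplication by the conjugate of the monomial
    l^a = prod_j (l_j)^(a_j).  The j-th operator of the shift sends H a into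
    H (a + e_j), so conjugating it by this diagonal operator multiplies it by
    l^(a + e_j) * conj (l^a), and this is l_j because l^a has modulus 1
    ([torus_rotation_rotates]).

    A diagonal operator with unimodular entries is an isometry whose adjoint has
    the conjugate entries, so it is unitary ([hsum_diag_unitary]); and
    l |-> conj (l^a) is a character of the torus for each a, which makes the
    family of these operators a representation
    ([torus_rotation_representation]).

    Strong continuity is the only analytic point.  Each character is continuous,
    but not uniformly in a.  For a fixed vector x, however, all but finitely many
    coordinates together carry an arbitrarily small part of the norm of x, and
    there the two diagonal operators differ by at most 2; on the remaining
    finitely many coordinates the entries converge uniformly.  Hence pointwise
    convergence of unimodular entries implies strong convergence of the diagonal
    operators ([hsum_diag_cvg]). *)

(** * Partial sums over finite sets *)

Section fset_sums.
Variables (R : realType) (I : choiceType) (u : I -> R).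
Hypothesis u0 : forall i, 0 <= u i.

Lemma ler_sum_fset_in (J K : {fset I}) :
  \sum_(i <- K | i \in J) u i <= \sum_(i <- J) u i.
Proof.
rewrite [leRHS](bigID (mem K)) /= -big_filter (perm_big [seq i <- J | i \in K]).
  by rewrite big_filter lerDl sumr_ge0.
apply: uniq_perm; rewrite ?filter_uniq ?fset_uniq//.
by move=> i; rewrite !mem_filter andbC.
Qed.

Lemma ler_sum_fset_notin (J K : {fset I}) : summabler u ->
  \sum_(i <- K | i \notin J) u i <= usum u - \sum_(i <- J) u i.
Proof.
(* The sum of u over the finite set J `|` K is at most [usum u]. *)
move=> su; rewrite lerBrDl.
apply: le_trans (ler_usum_fset (J `|` K)%fset u0 su).
rewrite [leRHS](bigID (mem J)) /=; apply: lerD.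
  rewrite -[leRHS]big_filter (perm_big [seq i <- (J `|` K)%fset | i \in J])//.
  apply: uniq_perm; rewrite ?filter_uniq ?fset_uniq//.
  by move=> i; rewrite mem_filter inE; case: (i \in J).
rewrite -big_filter -[leRHS]big_filter.
rewrite (perm_big [seq i <- (J `|` K)%fset | i \notin J])//.
apply: uniq_perm; rewrite ?filter_uniq ?fset_uniq//.
by move=> i; rewrite !mem_filter inE; case: (i \in J).
Qed.

Lemma usum_fset_approx (e : R) : 0 < e ->
  exists J : {fset I}, usum u - e < \sum_(i <- J) u i.
Proof.
move=> e0; apply: contrapT => /forallNP uJ.
suff : usum u <= usum u - e by rewrite lerBrDr gerDl leNgt e0.
by apply: ler_usum_bound => // J; rewrite leNgt; apply/negP; exact: uJ.
Qed.

End fset_sums.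

(** * Unimodular scalars *)

Section unimodular.
Variable R : realType.

Lemma mulcJ_unimodular (z : R[i]) : `|z| = 1 -> z * z^*%R = 1.
Proof. by move=> z1; rewrite -normCK z1 expr1n. Qed.

Lemma unimodular_conj (I : Type) (c : I -> R[i]) : (forall i, `|c i| = 1) ->
  forall i, `|(c i)^*%R| = 1.
Proof. by move=> c1 i; rewrite norm_conjC. Qed.

Lemma unimodular_dist2 (z w : R[i]) : `|z| = 1 -> `|w| = 1 ->
  complex.Re `|z - w| ^+ 2 <= 4.
Proof.
move=> z1 w1; have h : `|z - w| <= 2%:R%:C.
  by apply: le_trans (ler_normB _ _) _; rewrite z1 w1 rmorph_nat -mulr2n.
have z0 : 0 <= complex.Re `|z - w| by rewrite -ler0c -normc_real.
move: h; rewrite (normc_real (normr_ge0 _)) lecR => h.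
have -> : 4 = 2%:R ^+ 2 :> R by rewrite -natrX.
by rewrite lerXn2r ?nnegrE.
Qed.

End unimodular.

(** * Unimodular diagonal operators on a direct sum *)

Section diagonal.
Variables (R : realType) (I : choiceType) (H : I -> hilbertType R).

Fact hsum_diag_summable (c : I -> R[i]) (c1 : forall i, `|c i| = 1) (x : hsum H) :
  summabler (fun i => rnorm (c i *: x i) ^+ 2).
Proof.
apply: summabler_le (hsum_summable x) => i.
by rewrite rnormZ c1 /= mul1r ger0_norm ?sqr_ge0.
Qed.

Definition hsum_diag c (c1 : forall i, `|c i| = 1) (x : hsum H) : hsum H :=
  HSum (hsum_diag_summable c1 x).

Fact hsum_diag_linear c (c1 : forall i, `|c i| = 1) : linear (hsum_diag c1).
Proof.
move=> k x y; apply: hsumP => i; rewrite hsum_valD hsum_valZ /=.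
by rewrite scalerDr !scalerA mulrC.
Qed.

HB.instance Definition _ c (c1 : forall i, `|c i| = 1) :=
  GRing.isLinear.Build R[i] (hsum H) (hsum H) *:%R (hsum_diag c1)
    (hsum_diag_linear c1).

Lemma hsum_diag_rnorm c (c1 : forall i, `|c i| = 1) x :
  rnorm (hsum_diag c1 x) = rnorm x.
Proof.
apply/eqP; rewrite -(@eqrXn2 _ 2)// ?rnorm_ge0// !hsum_rnorm2; apply/eqP.
by congr usum; apply/funext => i /=; rewrite rnormZ c1 mul1r.
Qed.

Lemma hsum_diag_inner c (c1 : forall i, `|c i| = 1) x y :
  inner (hsum_diag c1 x) y = inner x (hsum_diag (unimodular_conj c1) y).
Proof.
have e i : inner (c i *: x i) (y i) = inner (x i) ((c i)^*%R *: y i).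
  by rewrite innerZl innerZr conjCK.
by congr (_ +i* _); congr usum; apply/funext => i /=; rewrite e.
Qed.

Lemma hsum_diag_adjoint c (c1 : forall i, `|c i| = 1) :
  adjoint (hsum_diag c1) =1 hsum_diag (unimodular_conj c1).
Proof. exact/adjointE/hsum_diag_inner. Qed.

Lemma hsum_diag_unitary c (c1 : forall i, `|c i| = 1) : unitary (hsum_diag c1).
Proof.
split.
- apply: le_lt_trans (ltry 1); apply: ge_opnorm => // x.
  by rewrite hsum_diag_rnorm mul1r.
- by move=> x y; rewrite hsum_diag_adjoint hsum_diag_inner.
- move=> x; rewrite hsum_diag_adjoint; apply: hsumP => i /=.
  by rewrite scalerA mulrC mulcJ_unimodular// scale1r.
- move=> x; rewrite hsum_diag_adjoint; apply: hsumP => i /=.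
  by rewrite scalerA mulcJ_unimodular// scale1r.
Qed.

(** Only pointwise convergence of the entries is required: the part of x outside
    a finite set of coordinates is small, and unimodularity keeps the entries
    there within distance 2 of their limits. *)
Lemma hsum_diag_cvg (T : Type) (F : set_system T) (FF : Filter F)
    (c : T -> I -> R[i]) (c1 : forall t i, `|c t i| = 1)
    (c0 : I -> R[i]) (c01 : forall i, `|c0 i| = 1) (x : hsum H) :
  (forall i, (c t i : R[i]^o) @[t --> F] --> (c0 i : R[i]^o)) ->
  hsum_diag (c1 t) x @[t --> F] --> hsum_diag c01 x.
Proof.
move=> cc0; apply/cvg_ballP => eps eps0.
have epsE := normc_real (ltW eps0); rewrite epsE.
set e := complex.Re eps.
have e0 : 0 < e by rewrite -ltcR -epsE.
pose t := e ^+ 2 / 16; have t0 : 0 < t by rewrite divr_gt0 ?exprn_gt0.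
have sq0 i : 0 <= rnorm (x i) ^+ 2 by exact: sqr_ge0.
(* J carries all of the squared norm of x except less than t; as
   4 * t = e ^+ 2 / 4, the tail contributes less than e ^+ 2 / 4. *)
have [J xJ] := usum_fset_approx sq0 t0.
rewrite -/(hsum_sqnorm x) in xJ.
set S := \sum_(i <- J) _ in xJ.
have S0 : 0 <= S by apply: sumr_ge0 => i _; exact: sqr_ge0.
(* On J the entries are required within del of their limits, where
   del ^+ 2 * S <= e ^+ 2 / 4; the summand 1 avoids dividing by zero. *)
pose del := Num.sqrt (e ^+ 2 / (4 * (S + 1))).
have d0 : 0 < del by rewrite sqrtr_gt0 divr_gt0 ?exprn_gt0 ?mulr_gt0 ?ltr_wpDl.
have FJ : F (fun s => forall i, i \in J -> complex.Re `|c0 i - c s i| < del).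
  have := @filter_bigI _ I J (fun i s => complex.Re `|c0 i - c s i| < del) F FF.
  move=> h; suff : F (\bigcap_(i in [set` J])
      [set s | complex.Re `|c0 i - c s i| < del]).
    by apply: filterS => s sJ i iJ; exact: sJ.
  apply: h => i _.
  have /cvg_ballP/(_ del%:C) := cc0 i; rewrite ltcR => /(_ d0).
  by apply: filterS => s /ball_rnorm.
apply: filterS FJ => s sJ; apply/ball_rnorm.
rewrite -(@ltr_pXn2r _ 2)// ?nnegrE ?rnorm_ge0 ?(ltW e0)// hsum_rnorm2.
have dist0 i : 0 <= complex.Re `|c0 i - c s i| by rewrite -ler0c -normc_real.
apply: (@le_lt_trans _ _ (del ^+ 2 * S + 4 * (hsum_sqnorm x - S))); last first.
  rewrite sqr_sqrtr ?divr_ge0 ?sqr_ge0 ?mulr_ge0 ?addr_ge0//.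
  have h1 : e ^+ 2 / (4 * (S + 1)) * S <= e ^+ 2 / 4.
    rewrite invfM mulrA -mulrA ler_piMr ?divr_ge0 ?sqr_ge0//.
    by rewrite mulrC ler_pdivrMr ?ltr_wpDl// mul1r lerDl.
  have : 0 < e ^+ 2 by rewrite exprn_gt0.
  by rewrite /t in xJ; lra.
apply: ler_usum_bound => [i|K]; first exact: sqr_ge0.
have termE i : rnorm ((hsum_diag c01 x - hsum_diag (c1 s) x) i) ^+ 2 =
    complex.Re `|c0 i - c s i| ^+ 2 * rnorm (x i) ^+ 2.
  by rewrite hsum_valB /= -scalerBl rnormZ exprMn.
under eq_bigr do rewrite termE.
rewrite (bigID (mem J)) /=; apply: lerD.
  apply: (@le_trans _ _ (\sum_(i <- K | i \in J) del ^+ 2 * rnorm (x i) ^+ 2)).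
    apply: ler_sum => i iJ; rewrite ler_wpM2r ?sqr_ge0//.
    by apply: lerXn2r; rewrite ?nnegrE ?(ltW d0) ?dist0//; exact/ltW/sJ.
  by rewrite -mulr_sumr ler_wpM2l ?sqr_ge0//; exact: ler_sum_fset_in.
apply: (@le_trans _ _ (\sum_(i <- K | i \notin J) 4 * rnorm (x i) ^+ 2)).
  apply: ler_sum => i _; rewrite ler_wpM2r ?sqr_ge0//.
  exact: unimodular_dist2.
rewrite -mulr_sumr ler_wpM2l//.
by apply: ler_sum_fset_notin => //; exact: hsum_summable.
Qed.

End diagonal.

(** * Characters of the torus *)

Section character.
Variables (d : nat) (R : realType).
Implicit Types (l m : 'rV[R[i]^o]_d) (a : multi_index d).

Definition monomial l a : R[i] := \prod_j (l ord0 j : R[i]) ^+ a j.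

Lemma monomialS l a j : monomial l (a + unit_index j) = monomial l a * l ord0 j.
Proof.
rewrite /monomial; under eq_bigr do rewrite !ffunE exprD.
rewrite big_split /=; congr (_ * _).
rewrite (bigD1 j)//= eqxx expr1 big1 ?mulr1// => k /negPf ->.
by rewrite expr0.
Qed.

Lemma monomial1 a : monomial (const_mx 1) a = 1.
Proof. by rewrite /monomial big1// => j _; rewrite mxE expr1n. Qed.

Lemma monomialM l m a :
  monomial (map2_mx *%R l m) a = monomial l a * monomial m a.
Proof.
by rewrite /monomial -big_split; apply: eq_bigr => j _; rewrite mxE exprMn.
Qed.

Lemma monomial_norm l a : torus d R l -> `|monomial l a| = 1.
Proof.
move=> lT; rewrite /monomial normr_prod big1// => j _.
by rewrite normrX (lT j) expr1n.
Qed.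

Lemma monomial_continuous a : continuous (fun l => monomial l a : R[i]^o).
Proof.
move=> l; have FF : Filter (nbhs l) by exact: nbhs_filter.
rewrite /continuous_at /monomial.
apply: (@cvg_big (R[i]^o) _ *%R 1 predT _ _ (nbhs l) _
  (fun j m => (m ord0 j : R[i]) ^+ a j)) => [|j _]; first exact: mul_continuous.
elim: (a j) => [|n IHn]; first exact: cvg_cst.
under eq_fun do rewrite exprS.
by rewrite exprS; apply: cvgM IHn; exact: coord_continuous.
Qed.

(** The conjugate, and not the monomial itself, gives the factor l_j rather
    than its inverse in [U^* S_j U = l_j S_j].  The value 1 off the torus keeps
    the family unimodular for every l, so that the diagonal operator below is
    defined on the whole ambient space of the torus. *)
Definition torus_character l a : R[i] :=
  if `[< torus d R l >] then (monomial l a)^*%R else 1.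

Lemma torus_characterE l a : torus d R l ->
  torus_character l a = (monomial l a)^*%R.
Proof. by move=> lT; rewrite /torus_character asboolT. Qed.

Lemma torus_character_norm l a : `|torus_character l a| = 1.
Proof.
rewrite /torus_character; case: asboolP => lT; last by rewrite normr1.
by rewrite norm_conjC monomial_norm.
Qed.

Lemma torus_character_cvg l a : torus d R l ->
  (torus_character m a : R[i]^o) @[m --> within (torus d R) (nbhs l)] -->
    (torus_character l a : R[i]^o).
Proof.
move=> lT; apply/cvgrPdist_lt => e e0.
have /cvgrPdist_lt/(_ e e0) := @monomial_continuous a l.
move=> h; apply: filterS h => m /= h mT.
by rewrite !torus_characterE// -rmorphB norm_conjC.
Qed.

End character.

(** * The rotations of a multishift *)

Section rotation.
Variables (d : nat) (R : realType) (H : multi_index d -> hilbertType R).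
Implicit Types (l m : 'rV[R[i]^o]_d).

Definition torus_rotation l : {linear hsum H -> hsum H} :=
  hsum_diag (torus_character_norm l).

Lemma torus1 : torus d R (const_mx 1).
Proof. by move=> j; rewrite mxE normr1. Qed.

Lemma torusM l m : torus d R l -> torus d R m -> torus d R (map2_mx *%R l m).
Proof. by move=> lT mT j; rewrite mxE normrM lT mT mulr1. Qed.

Lemma torus_rotation_representation : torus_representation torus_rotation.
Proof.
split.
- by move=> l _; exact: hsum_diag_unitary.
- move=> x; apply: hsumP => a /=.
  by rewrite torus_characterE ?monomial1 ?rmorph1 ?scale1r//; exact: torus1.
- move=> l m lT mT x; apply: hsumP => a /=.
  rewrite scalerA !torus_characterE//; last exact: torusM.
  by rewrite monomialM rmorphM.
Qed.

Lemma torus_rotation_continuous : strongly_continuous torus_rotation.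
Proof.
move=> h; apply/subspace_continuousP => l lT.
by apply: hsum_diag_cvg => a; exact: torus_character_cvg.
Qed.

(** On the coordinates with a_j = 0 both sides vanish; on those of the form
    a + e_j the scalar is l^(a + e_j) * conj (l^a) = l_j * (l^a * conj (l^a)). *)
Lemma torus_rotation_rotates (A : weights H) (cA : commuting_weights A) l :
  torus d R l -> rotates (multishift cA) l (torus_rotation l).
Proof.
move=> lT; split; first exact: hsum_diag_unitary.
move=> j x; rewrite hsum_diag_adjoint; apply: hsumP.
apply: (@multi_index_ind _ j) => a.
  by move=> aj; rewrite hsum_valZ /= !shift_family0// !scaler0.
rewrite hsum_valZ /= !shift_familyS /= linearZ scalerA; congr (_ *: _).
rewrite !torus_characterE// conjCK monomialS mulrAC.
by rewrite mulcJ_unimodular ?mul1r// monomial_norm.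
Qed.

End rotation.

Theorem proposition4p1 (R : realType) (d : nat) (d_ge1 : (1 <= d)%N)
    (H : multi_index d -> hilbertType R)
    (H_separable : forall a, separable (H a))
    (A : weights H) (cA : commuting_weights A) :
  strongly_circular (multishift cA).
Proof.
split.
  by move=> l lT; exists (torus_rotation H l); exact: torus_rotation_rotates.
exists (torus_rotation H); split.
- by move=> l; exact: torus_rotation_rotates.
- exact: torus_rotation_representation.
- exact: torus_rotation_continuous.
Qed.
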